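(* For every $s\in\mathbb{N}$ there exist a rooted tree $T$ and a path $P$ such that the graph $G_{T,P}$ has stack number exceeding $s$.
   Context: Graphs are finite, simple and undirected. For a rooted tree $T$ and a path $P$ with vertex set $\{1,2,\dots,m\}$ (edges $i\sim i+1$), $G_{T,P}$ is the graph with vertex set $V(T)\times\{1,\dots,m\}$ and three types of edges: vertical edges $(v,i)\sim(p,i)$ where $p$ is the parent of $v$ in $T$ and $1\le i\le m$; diagonal edges $(v,i)\sim(p,i+1)$ where $p$ is the parent of $v$ in $T$ and $1\le i\le m-1$; horizontal edges $(v,i)\sim(v,i+1)$ where $v\in V(T)$ and $1\le i\le m-1$. Let $L$ be a linear order on $V(G)$. Two edges with no common endpoint, written as $(a,b)$, $(c,d)$ with $a<b$ and $c<d$ in $L$, cross if $a<c<b<d$ or $c<a<d<b$; edges sharing an endpoint do not cross. A $k$-stack layout of $G$ is a pair $(L,\phi)$ where $L$ is a total order on $V(G)$ and $\phi$ is a colouring of $E(G)$ with $k$ colours (not necessarily proper) such that no two edges of the same colour cross with respect to $L$. The stack number of $G$ is the smallest integer $k$ such that $G$ admits a $k$-stack layout. *)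

(* Defs.v *)
From mathcomp Require Import all_boot.
From mathcomp Require Import boolp.

Set Implicit Arguments.
Unset Strict Implicit.
Unset Printing Implicit Defensive.

Record sgraph := SGraph {
  vertex :> finType;
  adj : rel vertex;
  adj_sym : symmetric adj;
  adj_irr : irreflexive adj }.

Definition edges (G : sgraph) : {set {set G}} :=
  [set [set p.1; p.2] | p : G * G & adj p.1 p.2].

Definition connected_graph (G : sgraph) : Prop :=
  forall x y : G, connect (@adj G) x y.

(* A cycle has at least 3 vertices: [ucycle] also accepts [::] and, since adj
   is symmetric, the closed walk x, y, x along a single edge. *)
Definition acyclic_graph (G : sgraph) : Prop :=
  forall c : seq G, ucycle (@adj G) c -> size c <= 2.

Record rooted_tree := RootedTree {
  tree_graph :> sgraph;
  root_of : tree_graph;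
  tree_connected : connected_graph tree_graph;
  tree_acyclic : acyclic_graph tree_graph }.

(* [parent v p]: p is the parent of v, i.e. the vertex following v on the
   simple path v, p, ..., root.  The length bound, which keeps the predicate
   boolean, is harmless: see [parentP]. *)
Definition parent (T : rooted_tree) (v p : T) : bool :=
  [exists n : 'I_#|T|, [exists s : n.-tuple T,
    [&& path (@adj T) v (p :: s), uniq [:: v, p & s] & last p s == root_of T]]].

Lemma parentP (T : rooted_tree) (v p : T) :
  reflect (exists s : seq T,
    [/\ path (@adj T) v (p :: s), uniq [:: v, p & s] & last p s = root_of T])
  (parent v p).
Proof.
apply: (iffP existsP) => [[n /existsP[s /and3P[hp hu /eqP hl]]]|].
  by exists s; split.
case=> s [hp hu hl].
have hs : size s < #|T|.
  by apply: leq_trans (max_card (mem [:: v, p & s])); rewrite (card_uniqP hu) /= ltnS leqnSn.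
exists (Ordinal hs); apply/existsP; exists (in_tuple s).
by apply/and3P; split=> //; apply/eqP.
Qed.

Lemma parent_irr (T : rooted_tree) : irreflexive (@parent T).
Proof.
by move=> v; apply/parentP => -[s [_ /=]]; rewrite inE eqxx.
Qed.

(* The path on m vertices is represented by 'I_m = {0, ..., m-1}. *)
Section TreePath.
Variables (T : rooted_tree) (m : nat).
Implicit Types x y : T * 'I_m.

Definition vertical x y : bool := parent x.1 y.1 && (y.2 == x.2).
Definition diagonal x y : bool := parent x.1 y.1 && (y.2 == x.2.+1 :> nat).
Definition horizontal x y : bool := (y.1 == x.1) && (y.2 == x.2.+1 :> nat).

Definition tp_arc x y : bool := [|| vertical x y, diagonal x y | horizontal x y].
Definition tp_adj x y : bool := tp_arc x y || tp_arc y x.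

Lemma tp_adj_sym : symmetric tp_adj.
Proof. by move=> x y; rewrite /tp_adj orbC. Qed.

Lemma tp_adj_irr : irreflexive tp_adj.
Proof.
move=> x; rewrite /tp_adj /tp_arc /vertical /diagonal /horizontal.
by rewrite parent_irr (ltn_eqF (ltnSn _)) !andbF.
Qed.

Definition tree_path_graph : sgraph := SGraph tp_adj_sym tp_adj_irr.
End TreePath.

Definition linear_order (V : finType) (L : rel V) : Prop :=
  [/\ reflexive L, antisymmetric L, transitive L & total L].

Definition strict (V : finType) (L : rel V) : rel V :=
  fun x y => (x != y) && L x y.

Definition cross (V : finType) (L : rel V) (e f : {set V}) : Prop :=
  [disjoint e & f] /\
  exists a b c d : V,
    [/\ e = [set a; b], f = [set c; d], strict L a b, strict L c d &
        [&& strict L a c, strict L c b & strict L b d] ||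
        [&& strict L c a, strict L a d & strict L d b]].

Definition stack_layout (G : sgraph) (k : nat) (L : rel G)
    (phi : {e : {set G} | e \in edges G} -> 'I_k) : Prop :=
  linear_order L /\
  forall e f, phi e = phi f -> ~ cross L (val e) (val f).

Definition has_stack_layout (G : sgraph) (k : nat) : Prop :=
  exists (L : rel G) (phi : {e : {set G} | e \in edges G} -> 'I_k),
    stack_layout L phi.

Lemma stack_layout_exists (G : sgraph) : exists k, `[< has_stack_layout G k >].
Proof.
exists #|{: {e : {set G} | e \in edges G}}|; apply/asboolP.
exists (fun x y => enum_rank x <= enum_rank y), (@enum_rank _); split.
  split=> [x|x y|y x z|x y] //; first 2 last.
  - exact: leq_total.
  - by rewrite -eqn_leq => /eqP /val_inj /enum_rank_inj.
  - exact: leq_trans.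
move=> e f /enum_rank_inj -> [] /[swap] [[a [b [c [d [-> _ _ _ _]]]]]].
by move=> /pred0P /(_ a) /=; rewrite !inE eqxx.
Qed.

Definition stack_number (G : sgraph) : nat := ex_minn (stack_layout_exists G).

(* Main.v *)
Require Import Defs.
From mathcomp Require Import all_boot.
From mathcomp Require Import boolp.
From mathcomp Require Import zify.

(** The tree consists of the subsets of a large set [{0, ..., D-1}], the parent of a
    set being obtained by deleting its maximum.  Suppose that the graph has a layout
    with [k] colours.  By Ramsey's theorem ([ramsey]) there is a large set of indices
    on which the layout is homogeneous: the order of the vertices of two branches that
    share their first [h] entries and are separated afterwards depends only on [h] and
    on the locations of the vertices in the grid of levels and columns, and the colour of
    an edge depends only on its location.

    For branches that split at the root, each location has a direction: its copies
    appear in the order of the branches, or in the reverse order.  Two copies of a grid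
    edge have the same colour and cannot cross.  Hence adjacent locations of the same
    direction have interleaved copies ([eqv_adj]), while adjacent locations of opposite
    directions have all their copies separated ([separated]).  The directions label the
    triangulated grid with two labels, and the two labels are separated by walls, which
    are curves in the dual graph.  Two configurations are impossible.

    - Many equivalent locations in the top row ([top_class_bound]): the copies of the
      root are joined to all branches, and two of these edges of the same colour can be
      chosen to cross.

    - A wall from the top row to the bottom row of a high grid ([spanning_wall_bound]).
      Across the wall, opposite directions persist for branches that split at
      any lower level ([opposite_persists]), so along one side of the wall copies remain
      interleaved.  Comparing two places where the wall descends, with equal colours,
      the edges from siblings to their parent across the wall give a crossing.

    One of them always occurs if the number of columns is exponential in the number of
    rows ([related_top_locs]).  Indeed, suppose that no wall spans all rows.  At each
    location of the top row, consider the walls from the top row that separate it from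
    the bottom row.  There are at most as many as there are rows, and they are nested,
    so this set evolves like a stack along the row.  At places where the size of the
    stack returns to the same value without having been lower, the location is on the
    same side of the same walls, and belongs to the same class.  Many such places exist
    by [frequent_minimum].  Planarity enters only through the fact that a wall has
    two sides, obtained by integrating a cocycle modulo 2 ([potentialE]). *)

Set Implicit Arguments.
Unset Strict Implicit.
Unset Printing Implicit Defensive.

(** * Ramsey's theorem for subsequences *)

Definition homogeneous (A : eqType) (K : Type) (r : nat) (c : seq A -> K)
    (M : seq A) (k : K) : Prop :=
  forall s, subseq s M -> size s = r -> c s = k.

(** The colour of a subsequence of [M] depends on its first entry alone: the
    list [ks] records which colour each entry forces. *)
Fixpoint head_coloured (A : eqType) (K : Type) (r : nat) (c : seq A -> K)
    (M : seq A) (ks : seq K) : Prop :=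
  match M, ks with
  | [::], [::] => True
  | x :: M', k :: ks' =>
      homogeneous r (fun s => c (x :: s)) M' k /\ head_coloured r c M' ks'
  | _, _ => False
  end.

Lemma head_coloured_size (A : eqType) (K : Type) r (c : seq A -> K) M ks :
  head_coloured r c M ks -> size ks = size M.
Proof. by elim: M ks => [|x M IH] [|k ks] //= [_ /IH ->]. Qed.

(** Among entries that force the same colour [k], every subsequence of length
    [r.+1] has that colour, whatever its first entry is. *)
Lemma head_coloured_mask (A : eqType) (K : eqType) r (c : seq A -> K) M ks k :
  head_coloured r c M ks ->
  homogeneous r.+1 c (mask [seq k' == k | k' <- ks] M) k.
Proof.
elim: M ks => [|x M IH] [|k' ks] //= => [_ s|].
  by rewrite subseq0 => /eqP->.
case=> hx hM s; case: eqP => [kk|_]; last exact: IH.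
case: s => [|y s] //=.
case: eqP => [-> hs [sz]|_ hs sz]; last exact: IH hs sz.
rewrite -kk; apply: hx sz.
exact: subseq_trans hs (mask_subseq _ _).
Qed.

Lemma homogeneous_sub (A : eqType) (K : Type) r (c : seq A -> K) M M' k :
  subseq M' M -> homogeneous r c M k -> homogeneous r c M' k.
Proof. by move=> sM h s /subseq_trans/(_ sM); apply: h. Qed.

Lemma pigeonhole_count (K : finType) (N : nat) (ks : seq K) :
  #|K| * N < size ks -> exists k, N < count_mem k ks.
Proof.
move=> hs; case: (pickP (fun k => N < count_mem k ks)) => [k|no]; first by exists k.
suff : size ks <= #|K| * N by rewrite leqNgt hs.
have -> : size ks = \sum_(k : K) count_mem k ks.
  elim: ks {hs no} => [|x ks IH] /=; first by rewrite big1.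
  rewrite big_split /= -IH (bigD1 x) //= eqxx big1 // => i.
  by rewrite eq_sym => /negbTE->.
rewrite -sum_nat_const; apply: leq_sum => k _.
by rewrite leqNgt no.
Qed.

(** Finite Ramsey for subsequences.  For length [r.+1] the list is thinned
    greedily: keep its head, and use the case [r] to make the colour of
    head-plus-[r]-later-entries constant on what remains.  This yields a
    [head_coloured] list, and the most frequent forced colour is the answer. *)
Theorem ramsey (K : finType) (r N : nat) :
  exists D, forall (A : eqType) (c : seq A -> K) (l : seq A), D <= size l ->
    exists M k, [/\ subseq M l, size M = N & homogeneous r c M k].
Proof.
elim: r N => [|r IHr] N.
  exists N => A c l hl; exists (take N l), (c [::]).
  split; first exact: take_subseq.
    exact: size_takel.
  by move=> s _ /size0nil->.
have heads t : exists D, forall (A : eqType) (c : seq A -> K) (l : seq A),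
    D <= size l -> exists M ks,
    [/\ subseq M l, size M = t & head_coloured r c M ks].
  elim: t => [|t [Dt IHt]].
    by exists 0 => A c l _; exists [::], [::]; rewrite sub0seq.
  have [D hD] := IHr Dt; exists D.+1 => A c [|x l] // hl.
  have [M [k [sM szM hM]]] := hD A (fun s => c (x :: s)) l hl.
  have [|M' [ks [sM' szM' hM']]] := IHt A c M; first by rewrite szM.
  exists (x :: M'), (k :: ks); split=> /=.
  - by rewrite eqxx; apply: subseq_trans sM' sM.
  - by rewrite szM'.
  - by split=> //; apply: homogeneous_sub hM.
have [D hD] := heads (#|K| * N).+1; exists D => A c l hl.
have [M [ks [sM szM hM]]] := hD A c l hl.
have szk := head_coloured_size hM.
have [|k hk] := @pigeonhole_count K N ks; first by rewrite szk szM.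
pose M' := mask [seq k' == k | k' <- ks] M.
have szM' : size M' = count_mem k ks.
  by rewrite size_mask ?size_map // count_map.
exists (take N M'), k; split.
- by apply: subseq_trans (take_subseq _ _) (subseq_trans (mask_subseq _ _) sM).
- by rewrite size_takel // szM' ltnW.
- by apply: homogeneous_sub (take_subseq _ _) (head_coloured_mask hM).
Qed.

(** * The tree of subsets *)

(** The subsets of [{0, ..., D-1}], where the parent deletes the largest element.
    The ancestors of a set are the initial segments of its increasing
    enumeration, so that any large subset of indices spans a copy of the
    same kind of tree: this is what makes Ramsey's theorem applicable. *)
Section SubsetTree.
Variable D : nat.
Implicit Types A B : {set 'I_D}.

Definition remove_max A : {set 'I_D} := [set i in A | [exists j in A, i < j]].

Lemma remove_max_proper A : A != set0 -> remove_max A \proper A.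
Proof.
case/set0Pn=> i0 hi0; rewrite properE; apply/andP; split.
  by apply/subsetP=> i; rewrite inE => /andP[].
case: (arg_maxnP (fun i : 'I_D => i : nat) hi0) => i hi imax.
apply/subsetPn; exists i => //; rewrite inE negb_and; apply/orP; right.
by apply/exists_inPn => j /imax; rewrite -leqNgt.
Qed.

Definition subset_arc A B : bool := (A != set0) && (B == remove_max A).
Definition subset_adj A B : bool := subset_arc A B || subset_arc B A.

Lemma subset_arc_card A B : subset_arc A B -> #|B| < #|A|.
Proof. by case/andP=> A0 /eqP->; apply/proper_card/remove_max_proper. Qed.

Lemma subset_adj_sym : symmetric subset_adj.
Proof. by move=> A B; rewrite /subset_adj orbC. Qed.

Lemma subset_adj_irr : irreflexive subset_adj.
Proof.
by move=> A; apply/negP => /orP[] /subset_arc_card; rewrite ltnn.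
Qed.

Definition subset_graph : sgraph := SGraph subset_adj_sym subset_adj_irr.

Lemma path_to_empty A : exists s,
  [/\ path subset_arc A s, last A s = set0 & all (fun B => #|B| < #|A|) s].
Proof.
have [k] := ubnP #|A|; elim: k A => // k IH A hA.
have [->|A0] := eqVneq A set0; first by exists [::].
have arcA : subset_arc A (remove_max A) by rewrite /subset_arc A0 /=.
have lt := subset_arc_card arcA.
have [|s [ps ls /allP hs]] := IH (remove_max A); first exact: leq_trans lt hA.
exists (remove_max A :: s); split=> //=; first by rewrite arcA.
rewrite lt /=; apply/allP => B /hs hB; exact: ltn_trans hB lt.
Qed.

Lemma subset_connected : connected_graph subset_graph.
Proof.
suff conn0 A : connect subset_adj A set0.
  move=> A B; apply: connect_trans (conn0 A) _.
  by rewrite (sym_connect_sym subset_adj_sym).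
have [s [ps ls _]] := path_to_empty A.
apply/connectP; exists s => //; apply: sub_path ps => B C h.
by rewrite /subset_adj h.
Qed.

(** On a cycle, both neighbours of a set of maximal size would be its parent. *)
Lemma subset_acyclic : acyclic_graph subset_graph.
Proof.
move=> c /andP[cyc uc]; rewrite leqNgt; apply/negP => sz.
have [x0 hx0] : exists x0, x0 \in c by case: c sz {cyc uc} => // x; exists x; rewrite mem_head.
case: (arg_maxnP (fun A : {set 'I_D} => #|A|) hx0) => A /= hA Amax.
have nxt B : subset_adj A B -> B \in c -> B = remove_max A.
  case/orP=> [/andP[_ /eqP]//|/subset_arc_card lt /Amax].
  by rewrite /= leqNgt lt.
have [i p E] := rot_to hA.
have cyc' : cycle subset_adj (A :: p) by rewrite -E rot_cycle.
have uc' : uniq (A :: p) by rewrite -E rot_uniq.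
have mem' B : B \in A :: p -> B \in c by rewrite -E mem_rot.
have sz' : 2 < size (A :: p) by rewrite -E size_rot.
case: p {E} cyc' uc' mem' sz' => [|B [|C p]] //=.
case/andP=> AB; rewrite rcons_path => /and3P[_ _ lA] uc' mem' _.
have eB : B = remove_max A by apply: nxt => //; apply: mem'; rewrite !inE eqxx orbT.
have eL : last C p = remove_max A.
  apply: nxt; first by rewrite subset_adj_sym.
  by apply: mem'; rewrite [_ \in _]in_cons [_ \in B :: _]in_cons mem_last !orbT.
by case/and3P: uc' => _; rewrite eB -eL mem_last.
Qed.

Definition subset_tree : rooted_tree :=
  @RootedTree subset_graph (set0 : {set 'I_D}) subset_connected subset_acyclic.

(** Sizes strictly decrease towards the root, hence the walk is simple. *)
Lemma subset_parent A : A != set0 -> @parent subset_tree A (remove_max A).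
Proof.
move=> A0; apply/parentP.
have arcA : subset_arc A (remove_max A) by rewrite /subset_arc A0 /=.
have [s [ps ls hs]] := path_to_empty (remove_max A).
have pA : path subset_arc A (remove_max A :: s) by rewrite /= arcA.
exists s; split=> //.
  by apply: sub_path pA => B C h /=; rewrite /subset_adj h.
have tr : transitive (fun B C : {set 'I_D} => #|C| < #|B|).
  by move=> B A' C h1 h2; apply: ltn_trans h2 h1.
apply: (@sorted_uniq _ _ tr _ (A :: remove_max A :: s)).
  by move=> B; rewrite /= ltnn.
apply: (sub_path _ pA) => B C; exact: subset_arc_card.
Qed.

Definition node (s : seq nat) : {set 'I_D} := [set i : 'I_D | val i \in s].

Lemma node_parent s x :
  x < D -> all (ltn^~ x) s -> @parent subset_tree (node (rcons s x)) (node s).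
Proof.
move=> xD /allP sx; have -> : node s = remove_max (node (rcons s x)).
  apply/setP => i; rewrite !inE mem_rcons inE.
  apply/idP/idP => [hi|/andP[/orP[/eqP ix|//] /exists_inP[j]]].
    rewrite hi orbT /=; apply/exists_inP; exists (Ordinal xD); last exact: sx.
    by rewrite !inE mem_rcons mem_head.
  rewrite inE mem_rcons inE => /orP[/eqP jx|/sx/= h]; rewrite -[_ < _]/(val i < val j) ix.
    by rewrite jx ltnn.
  by rewrite ltnNge ltnW.
apply: subset_parent; apply/set0Pn; exists (Ordinal xD).
by rewrite inE mem_rcons mem_head.
Qed.

Lemma node_inj s s' :
  sorted ltn s -> sorted ltn s' -> all (ltn^~ D) s -> all (ltn^~ D) s' ->
  node s = node s' -> s = s'.
Proof.
move=> ss ss' /allP sD /allP sD' /setP e.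
apply: (irr_sorted_eq ltn_trans ltnn) => // x.
have [xD|xD] := ltnP x D.
  by have := e (Ordinal xD); rewrite !inE.
by apply/idP/idP => [/sD|/sD'] /=; rewrite ltnNge xD.
Qed.
End SubsetTree.

(** * Walls in a two-labelled triangulated grid *)

Section Grid.
Variables n m : nat.
(** A location is a row and a column of the grid made by a root-to-leaf path of
    the tree and the horizontal path; row [r] is level [r.+1] of the tree. *)
Definition loc : finType := ('I_n.+1 * 'I_m.+1)%type.

Definition loc_arc (p q : loc) : bool :=
  [|| (q.1 == p.1 :> nat) && (q.2 == p.2.+1 :> nat),
      (q.1 == p.1.+1 :> nat) && (q.2 == p.2 :> nat) |
      (q.1 == p.1.+1 :> nat) && (p.2 == q.2.+1 :> nat)].
Definition loc_adj p q := loc_arc p q || loc_arc q p.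

Definition pt (r j : nat) : loc := (inord r, inord j).

Lemma loc_adjC : symmetric loc_adj.
Proof. by move=> p q; rewrite /loc_adj orbC. Qed.

Lemma pt_adj_h r j : r <= n -> j < m -> loc_adj (pt r j) (pt r j.+1).
Proof. by move=> h1 h2; rewrite /loc_adj /loc_arc /= !inordK //; lia. Qed.

Lemma pt_adj_v r j : r < n -> j <= m -> loc_adj (pt r j) (pt r.+1 j).
Proof. by move=> h1 h2; rewrite /loc_adj /loc_arc /= !inordK //; lia. Qed.

Lemma pt_adj_d r j : r < n -> j < m -> loc_adj (pt r j.+1) (pt r.+1 j).
Proof. by move=> h1 h2; rewrite /loc_adj /loc_arc /= !inordK //; lia. Qed.

Lemma ptE (p : loc) : p = pt p.1 p.2.
Proof. by case: p => i j; rewrite /pt /= !inord_val. Qed.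

Lemma loc_arcP (P : loc -> loc -> Prop) :
  (forall r j, r <= n -> j < m -> P (pt r j) (pt r j.+1)) ->
  (forall r j, r < n -> j <= m -> P (pt r j) (pt r.+1 j)) ->
  (forall r j, r < n -> j < m -> P (pt r j.+1) (pt r.+1 j)) ->
  forall p q, loc_arc p q -> P p q.
Proof.
move=> hh hv hd p q; rewrite (ptE p) (ptE q).
case: p q => [[r r1] [j j1]] [[r' r2] [j' j2]] /=.
rewrite /loc_arc /= !inordK //.
case/or3P=> /andP[/eqP e1 /eqP e2]; move: r2 j2; rewrite e1 e2 ?ltnS => r2 j2.
- exact: hh.
- exact: hv.
- by apply: hd => //; rewrite -ltnS -e2.
Qed.

(** Induction along paths of the grid, in the form of its connectedness. *)
Lemma loc_connected (Z : loc -> Prop) p0 :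
  Z p0 -> (forall p q, loc_adj p q -> Z p -> Z q) -> forall p, Z p.
Proof.
move=> Z0 Zadj.
have toorig p : Z p <-> Z (pt 0 0).
  rewrite (ptE p); case: p => [[r hr] [j hj]] /=.
  elim: r hr => [|r IH] hr.
    elim: j hj => [|j IH] hj //; rewrite -IH; last exact: ltnW.
    by split; apply: Zadj; [rewrite loc_adjC|]; apply: pt_adj_h.
  rewrite -IH; last exact: ltnW.
  by split; apply: Zadj; [rewrite loc_adjC|]; apply: pt_adj_v.
by move=> p; apply/toorig/(toorig p0).
Qed.

(** The grid is simply connected: a set of edges that meets each triangle in an
    even number of edges is the boundary of a set of locations.  The set is found
    by summing the edges crossed along the top row and then down a column. *)
Section Potential.
Variable x : loc -> loc -> bool.
Hypothesis xC : forall p q, x p q = x q p.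
Hypothesis x_triangle : forall p q o,
  loc_adj p q -> loc_adj q o -> loc_adj p o -> x p o = x p q (+) x q o.

Fixpoint row_sum (j : nat) : bool :=
  if j is j'.+1 then row_sum j' (+) x (pt 0 j') (pt 0 j) else false.
Fixpoint grid_sum (r j : nat) : bool :=
  if r is r'.+1 then grid_sum r' j (+) x (pt r' j) (pt r j) else row_sum j.
Definition potential (p : loc) := grid_sum p.1 p.2.

Lemma potentialE p q : loc_adj p q -> potential q = potential p (+) x p q.
Proof.
have hor r j : r <= n -> j < m ->
    grid_sum r j.+1 = grid_sum r j (+) x (pt r j) (pt r j.+1).
  elim: r => [|r IH] //= hr hj.
  rewrite IH //; last exact: ltnW.
  have e1 := x_triangle (pt_adj_h (ltnW hr) hj) (pt_adj_d hr hj) (pt_adj_v hr (ltnW hj)).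
  have e2 := x_triangle (pt_adj_d hr hj) (pt_adj_h hr hj) (pt_adj_v hr hj).
  rewrite e1 e2.
  by case: (grid_sum r j); case: (x _ _); case: (x _ _); case: (x _ _).
have arc : forall p q, loc_arc p q -> potential q = potential p (+) x p q.
  apply: loc_arcP => r j hr hj;
    rewrite /potential [(pt _ _).1]/= [(pt _ _).2]/= /= ?inordK //=; try lia.
    exact: hor.
  have e1 := x_triangle (pt_adj_h (ltnW hr) hj) (pt_adj_d hr hj) (pt_adj_v hr (ltnW hj)).
  rewrite hor //; last exact: ltnW.
  rewrite e1.
  by case: (grid_sum r j); case: (x _ _); case: (x _ _).
case/orP=> /arc -> //.
by rewrite xC -addbA addbb addbF.
Qed.
End Potential.

Variable s : loc -> bool.
Definition edge : finType := (loc * loc)%type.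
(** An edge on which the labelling [s] changes, oriented from true to false. *)
Definition opposite (e : edge) : bool := [&& loc_adj e.1 e.2, s e.1 & ~~ s e.2].
(** Two edges of change that lie in a common triangle.  A triangle has none or
    two of them, so the classes of the generated equivalence are curves in the
    dual graph: the walls, which separate the two labels. *)
Definition turn : rel edge := fun e f =>
  [&& opposite e, opposite f &
   (e.1 == f.1) && loc_adj e.2 f.2 || (e.2 == f.2) && loc_adj e.1 f.1].

Lemma turn_sym : symmetric turn.
Proof.
move=> e f; rewrite /turn andbCA; congr [&& _, _ & _].
by rewrite (eq_sym e.1) (eq_sym e.2) (loc_adjC e.1) (loc_adjC e.2).
Qed.
Let turn_csym := sym_connect_sym turn_sym.

(** The wall that the edge [p q] crosses, named by a representative edge. *)
Definition wall (p q : loc) : option edge :=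
  if s p == s q then None else Some (root turn (if s p then (p, q) else (q, p))).

Lemma wallC p q : wall p q = wall q p.
Proof. by rewrite /wall eq_sym; case: (s p) (s q) => [] []. Qed.

Lemma wall_triangle p q o g :
  loc_adj p q -> loc_adj q o -> loc_adj p o ->
  (wall p o == Some g) = (wall p q == Some g) (+) (wall q o == Some g).
Proof.
move=> pq qo po.
have eqr e f : turn e f -> root turn e = root turn f.
  by move=> h; apply/(rootP turn_csym)/connect1.
have qp : loc_adj q p by rewrite loc_adjC.
have oq : loc_adj o q by rewrite loc_adjC.
have op : loc_adj o p by rewrite loc_adjC.
have tl a b c : loc_adj a c -> loc_adj b c -> loc_adj a b -> s a -> s b -> s c = false ->
    root turn (a, c) = root turn (b, c).
  by move=> h1 h2 h3 sa sb sc; apply: eqr; rewrite /turn /opposite /= h1 h2 h3 sa sb sc eqxx orbT.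
have tr a b c : loc_adj a b -> loc_adj a c -> loc_adj b c -> s a -> s b = false -> s c = false ->
    root turn (a, b) = root turn (a, c).
  by move=> h1 h2 h3 sa sb sc; apply: eqr; rewrite /turn /opposite /= h1 h2 h3 sa sb sc eqxx.
rewrite /wall; case sp: (s p); case sq: (s q); case so: (s o) => /=;
  rewrite ?addbF ?addFb.
- by [].
- by rewrite (tl p q o).
- by rewrite (tl p o q) // addbb.
- by rewrite (tr p q o).
- by rewrite (tl q o p).
- by rewrite (tr q p o) // addbb.
- by rewrite (tr o p q).
- by [].
Qed.

(** The side of the wall [g] that does not contain the bottom left corner. *)
Definition inside (g : edge) (p : loc) : bool :=
  let pot := potential (fun p q => wall p q == Some g) in
  pot p (+) pot (pt n 0).

Lemma insideE g p q : loc_adj p q ->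
  inside g q = inside g p (+) (wall p q == Some g).
Proof.
move=> pq; rewrite /inside.
rewrite (@potentialE (fun p q => wall p q == Some g) _ _ p q) //.
- by rewrite addbAC.
- by move=> a b; rewrite wallC.
- by move=> a b c; apply: wall_triangle.
Qed.

Definition along (g : edge) (p : loc) : Prop := exists2 q, loc_adj p q & wall p q = Some g.

Lemma along_ind (g : edge) (P : loc -> loc -> Prop) :
  (forall e f, turn e f -> P e.1 e.2 -> P f.1 f.2) ->
  forall p q p' q', loc_adj p q -> loc_adj p' q' -> s p -> s p' ->
  wall p q = Some g -> wall p' q' = Some g -> P p q -> P p' q'.
Proof.
move=> Pt p q p' q' pq pq' sp sp'.
rewrite /wall sp sp'; case sq: (s q) => //=; case sq': (s q') => //=.
move=> [<-] [/esym] /(rootP turn_csym) /connectP[l pl el] Ppq.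
have: P (last (p, q) l).1 (last (p, q) l).2.
  move: Ppq; rewrite -[p]/(p, q).1 -[X in P _ X]/(p, q).2.
  elim: l (p, q) pl {el} => [|f l IH] e //= /andP[ef fl] Pe.
  by apply: IH fl (Pt _ _ ef Pe).
by rewrite -el.
Qed.

Lemma alongP (g : edge) (p : loc) : along g p -> exists a b,
  [/\ loc_adj a b, s a, s b = false, wall a b = Some g & p = if s p then a else b].
Proof.
case=> q pq w; case sp: (s p); [exists p, q | exists q, p].
  by split=> //; move: w; rewrite /wall sp; case: (s q).
by rewrite loc_adjC wallC; split=> //; move: w; rewrite /wall sp; case: (s q).
Qed.

(** Distinct walls do not cross: a wall stays on one side of any other one. *)
Lemma inside_along g g' p q : g != g' -> along g p -> along g q ->
  inside g' p = inside g' q.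
Proof.
move=> gg /alongP[a [b [ab sa sb w ->]]] /alongP[a' [b' [ab' sa' sb' w' ->]]].
have acc c d : loc_adj c d -> wall c d = Some g -> inside g' d = inside g' c.
  move=> cd wcd; rewrite (insideE _ cd) wcd; case: eqP => [[e]|_]; last by rewrite addbF.
  by rewrite e eqxx in gg.
have same c d : loc_adj c d -> s c = s d -> inside g' d = inside g' c.
  by move=> cd e; rewrite (insideE _ cd) /wall e eqxx addbF.
have key : inside g' a' = inside g' a /\ inside g' b' = inside g' b.
  apply: (@along_ind g (fun c d => inside g' c = inside g' a /\ inside g' d = inside g' b)
    _ a b a' b') => // -[c d] [c' d'] /and3P[/and3P[/= _ sc sd] /and3P[/= _ sc' sd']].
  case/orP=> /andP[/eqP <- h] [<- <-]; split=> //; apply: same => //.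
    by rewrite (negbTE sd) (negbTE sd').
  by rewrite sc sc'.
case: key => ka kb; have kab := acc _ _ ab w.
by case: (s p); case: (s q); rewrite ?ka ?kb ?kab.
Qed.

(** The two sides of a wall carry the two labels. *)
Lemma inside_side g p q : along g p -> along g q ->
  (inside g p == inside g q) = (s p == s q).
Proof.
move=> /alongP[a [b [ab sa sb w ep]]] /alongP[a' [b' [ab' sa' sb' w' eq]]].
have same c d : loc_adj c d -> s c = s d -> inside g d = inside g c.
  by move=> cd e; rewrite (insideE _ cd) /wall e eqxx addbF.
have kab : inside g b = ~~ inside g a by rewrite (insideE _ ab) w eqxx addbT.
have [ka kb] : inside g a' = inside g a /\ inside g b' = inside g b.
  apply: (@along_ind g (fun c d => inside g c = inside g a /\ inside g d = inside g b)
    _ a b a' b') => // -[c d] [c' d'] /and3P[/and3P[/= _ sc sd] /and3P[/= _ sc' sd']].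
  case/orP=> /andP[/eqP <- h] [<- <-]; split=> //; apply: same => //.
    by rewrite (negbTE sd) (negbTE sd').
  by rewrite sc sc'.
by rewrite ep eq; case: (s p); case: (s q);
  rewrite ?sa ?sb ?sa' ?sb' ?ka ?kb ?kab; case: (inside g a).
Qed.

(** In the application [E] is an equivalence that contains all pairs of adjacent
    locations with equal labels; [E] thus contains the components of a label. *)
Section SameSide.
Variable E : loc -> loc -> Prop.
Hypothesis E_refl : forall p, E p p.
Hypothesis E_trans : forall p q o, E p q -> E q o -> E p o.
Hypothesis E_adj : forall p q, loc_adj p q -> s p = s q -> E p q.

Lemma along_same_side g p q : along g p -> along g q -> s p = s q -> E p q.
Proof.
move=> /alongP[a [b [ab sa sb w ep]]] /alongP[a' [b' [ab' sa' sb' w' eq]]] spq.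
have [ka kb] : E a a' /\ E b b'.
  apply: (@along_ind g (fun c d => E a c /\ E b d)
    _ a b a' b') => // -[c d] [c' d'] /and3P[/and3P[/= _ sc sd] /and3P[/= _ sc' sd']].
  case/orP=> /andP[/eqP <- h] [h1 h2]; split=> //.
    by apply: E_trans h2 _; apply: E_adj => //; rewrite (negbTE sd) (negbTE sd').
  by apply: E_trans h1 _; apply: E_adj => //; rewrite sc sc'.
by rewrite ep eq -spq; case: (s p).
Qed.

Hypothesis no_spanning_wall : forall i j g, i < m -> j < m ->
  wall (pt 0 i) (pt 0 i.+1) = Some g -> wall (pt n j) (pt n j.+1) = Some g -> False.

Definition from_top (g : edge) : bool :=
  has (fun j => wall (pt 0 j) (pt 0 j.+1) == Some g) (iota 0 m).

Lemma from_topI g j : j < m -> wall (pt 0 j) (pt 0 j.+1) = Some g -> from_top g.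
Proof. by move=> hj w; apply/hasP; exists j; rewrite ?mem_iota ?w. Qed.

Lemma outside_bottom g j : from_top g -> j <= m -> inside g (pt n j) = false.
Proof.
case/hasP=> i; rewrite mem_iota /= => hi /eqP wi.
elim: j => [|j IH] hj; first by rewrite /inside addbb.
rewrite (insideE _ (pt_adj_h (leqnn n) hj)) IH; last exact: ltnW.
by case: eqP => // wj; case: (no_spanning_wall hi hj wi wj).
Qed.

(** The walls that start in the top row and separate [p] from the bottom. *)
Definition enclosing (p : loc) : {set edge} := [set g | from_top g && inside g p].

Lemma crossing_time (f : nat -> bool) a b : a <= b -> f a != f b ->
  exists t, [/\ a <= t, t < b, f t = f a & f t.+1 = f b].
Proof.
elim: b => [|b IH]; first by rewrite leqn0 => /eqP->; rewrite eqxx.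
rewrite leq_eqVlt => /orP[/eqP->|]; first by rewrite eqxx.
rewrite ltnS => ab ne; have [e|e] := eqVneq (f a) (f b); first by exists b; rewrite e.
have [t [h1 h2 h3 h4]] := IH ab e; exists t; split=> //; first exact: ltnW.
by rewrite h4; move: e ne; case: (f a); case: (f b); case: (f b.+1).
Qed.

(** The column below [(0, j)] crosses each enclosing wall, and has [n] edges. *)
Lemma card_enclosing j : j <= m -> #|enclosing (pt 0 j)| <= n.
Proof.
move=> hj; pose ws := pmap id [seq wall (pt i j) (pt i.+1 j) | i <- iota 0 n].
have szw : size ws <= n.
  rewrite size_pmap; apply: leq_trans (count_size _ _) _.
  by rewrite size_map size_iota.
apply: leq_trans szw; rewrite cardE; apply: uniq_leq_size; first exact: enum_uniq.
move=> g; rewrite mem_enum inE => /andP[tg ing].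
have [||i [_ hi e1 e2]] := @crossing_time (fun i => inside g (pt i j)) 0 n => //.
  by rewrite ing outside_bottom.
have adj := pt_adj_v hi hj.
have := insideE g adj; rewrite e1 e2 ing outside_bottom //= => /esym/negbFE/eqP w.
rewrite mem_pmap map_id -w; apply/mapP; exists i => //.
by rewrite mem_iota.
Qed.

(** The bottom row is outside of both walls.  A path from there meets one of the
    walls first, at a point outside of the other one. *)
Lemma not_mutually_inside g g' p p' : g != g' -> from_top g -> from_top g' ->
  along g p -> along g' p' -> inside g' p -> inside g p' -> False.
Proof.
move=> gg tg tg' ap ap' ip ip'.
have gg' : g' != g by rewrite eq_sym.
have Z := @loc_connected (fun q => inside g q = false /\ inside g' q = false) (pt n 0).
have [||] := Z _ _ p'; rewrite ?ip' //; first by rewrite !outside_bottom.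
move=> {}q o qo [h1 h2].
have oq : loc_adj o q by rewrite loc_adjC.
have i1 := insideE g qo; have i2 := insideE g' qo; rewrite h1 h2 /= in i1 i2.
case: eqP i1 => [w|_] i1.
  have ao : along g o by exists q; rewrite // wallC.
  have e : inside g' o by rewrite -(inside_along gg ap ao).
  by move: i2; rewrite e w; case: eqP => // -[h]; rewrite h eqxx in gg.
split; first exact: i1.
case: eqP i2 => [w i2|_ ->]; last by [].
have ao : along g' o by exists q; rewrite // wallC.
by rewrite -(inside_along gg' ap' ao) ip' in i1.
Qed.

Lemma along_enclosing g p q : along g p -> along g q -> inside g p = inside g q ->
  enclosing p = enclosing q.
Proof.
move=> ap aq e; apply/setP => g'; rewrite !inE.
have [<-|gg] := eqVneq g g'; first by rewrite -e.
by rewrite (inside_along gg ap aq).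
Qed.

Lemma enclosing_step j g : j < m -> wall (pt 0 j) (pt 0 j.+1) = Some g ->
  inside g (pt 0 j) = false ->
  g \notin enclosing (pt 0 j) /\ enclosing (pt 0 j.+1) = g |: enclosing (pt 0 j).
Proof.
move=> hj w ig; have adj := pt_adj_h (leq0n n) hj; split; first by rewrite inE ig andbF.
apply/setP => g'; rewrite !inE (insideE _ adj) w.
have [->|gg] := eqVneq g' g; first by rewrite (from_topI hj w) ig eqxx.
by case: eqP => [[h]|_]; [rewrite h eqxx in gg | rewrite addbF].
Qed.

Lemma enclosing_step_back j g : j < m -> wall (pt 0 j) (pt 0 j.+1) = Some g ->
  inside g (pt 0 j) = true ->
  g \notin enclosing (pt 0 j.+1) /\ enclosing (pt 0 j) = g |: enclosing (pt 0 j.+1).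
Proof.
move=> hj w ig; have adj := pt_adj_h (leq0n n) hj.
split; first by rewrite inE (insideE _ adj) ig w eqxx andbF.
apply/setP => g'; rewrite !inE (insideE _ adj) w.
have [->|gg] := eqVneq g' g; first by rewrite (from_topI hj w) ig.
by case: eqP => [[h]|_]; [rewrite h eqxx in gg | rewrite addbF].
Qed.

Lemma cross_along j g : j < m -> inside g (pt 0 j) != inside g (pt 0 j.+1) ->
  along g (pt 0 j) /\ along g (pt 0 j.+1).
Proof.
move=> hj; have adj := pt_adj_h (leq0n n) hj.
rewrite (insideE _ adj); case: (wall _ _ =P Some g) => [w _|_]; last by rewrite addbF eqxx.
split; first by exists (pt 0 j.+1).
by exists (pt 0 j); rewrite 1?loc_adjC // wallC.
Qed.

Let depth j := #|enclosing (pt 0 j)|.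

(** Walls nest, so that going along the top row the set of enclosing walls
    evolves like a stack.  If the depth is equal at [q] and [q'] and larger in
    between, then the wall pushed after [q] must be the one popped before
    [q'], and both locations lie along its outer side. *)
Lemma same_depth_related q q' : q <= q' -> q' <= m -> depth q = depth q' ->
  (forall t, q <= t <= q' -> depth q <= depth t) -> E (pt 0 q) (pt 0 q').
Proof.
have [k] := ubnP (q' - q); elim: k q q' => // k IH q q' hk qq' hm eqd mind.
have [->|ne] := eqVneq q q'; first exact: E_refl.
have {ne} lt : q < q' by rewrite ltn_neqAle ne.
(* An intermediate location of the same depth splits the interval. *)
case: (boolP (has (fun t => depth t == depth q) (iota q.+1 (q'.-1 - q)))).
  case/hasP=> t; rewrite mem_iota => ht /eqP dt.
  apply: (@E_trans _ (pt 0 t)); apply: IH; try lia.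
    by move=> u hu; apply: mind; lia.
  by move=> u hu; rewrite dt; apply: mind; lia.
move/hasPn => no; have {no} strict t : q < t < q' -> depth t != depth q.
  by move=> ht; apply: no; rewrite mem_iota; lia.
have hq : q < m by apply: leq_trans lt hm.
have adjq := pt_adj_h (leq0n n) hq.
case wq: (wall (pt 0 q) (pt 0 q.+1)) => [g|]; last first.
  have e : enclosing (pt 0 q.+1) = enclosing (pt 0 q).
    by apply/setP => g; rewrite !inE (insideE _ adjq) wq addbF.
  have [h|h] := ltnP q.+1 q'.
    by move: (strict q.+1); rewrite /depth e ltnSn h eqxx => /(_ isT).
  have -> : q' = q.+1 by apply/eqP; rewrite eqn_leq h lt.
  apply: E_adj => //; move: wq; rewrite /wall; case: eqP => //.
have dq1 : depth q <= depth q.+1 by apply: mind; rewrite leqnSn lt.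
case ig: (inside g (pt 0 q)).
  have [h1 h2] := enclosing_step_back hq wq ig.
  by move: dq1; rewrite /depth h2 cardsU1 h1 ltnn.
have [gq hG] := enclosing_step hq wq ig.
have tg := from_topI hq wq.
have ig1 : inside g (pt 0 q.+1) by rewrite (insideE _ adjq) wq ig eqxx.
have dq : depth q.+1 = (depth q).+1 by rewrite /depth hG cardsU1 gq.
have lt2 : q.+1 < q'.
  rewrite ltn_neqAle lt andbT; apply/eqP => e.
  by move: eqd; rewrite -e dq => /n_Sn.
pose u := q'.-1; have eu : u.+1 = q' by rewrite /u; lia.
have q1u : q.+1 <= u by rewrite -ltnS eu.
have hu : u < m by rewrite eu.
have adju := pt_adj_h (leq0n n) hu.
have du : depth q <= depth u by apply: mind; lia.
have sdu : depth u != depth q by apply: strict; lia.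
case wu: (wall (pt 0 u) (pt 0 u.+1)) => [g'|]; last first.
  have e : enclosing (pt 0 u.+1) = enclosing (pt 0 u).
    by apply/setP => g'; rewrite !inE (insideE _ adju) wu addbF.
  by move: sdu; rewrite eqd -eu /depth e eqxx.
have tg' := from_topI hu wu.
have [aq aq1] : along g (pt 0 q) /\ along g (pt 0 q.+1).
  by apply: cross_along => //; rewrite ig ig1.
case iu: (inside g' (pt 0 u)); last first.
  have [h1 h2] := enclosing_step hu wu iu.
  by move: du; rewrite eqd -eu /depth h2 cardsU1 h1 ltnn.
have iq' : inside g' (pt 0 q') = false by rewrite -eu (insideE _ adju) wu iu eqxx.
have [au aq'] : along g' (pt 0 u) /\ along g' (pt 0 q').
  by rewrite -eu; apply: cross_along => //; rewrite eu iu iq'.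
(* [g] is pushed right after [q], and [g'] is popped right before [q'] = u.+1. *)
have [gg|gg] := eqVneq g g'.
  rewrite -gg in iq' aq'; apply: (along_same_side aq aq').
  by apply/eqP; rewrite -(inside_side aq aq') ig iq'.
(* If [g] is still there at [q'], then [g'] came later or encloses [g]; if not,
   then [g] was popped in between, at a location of the depth of [q]. *)
case iq: (inside g (pt 0 q')).
  case i'q: (inside g' (pt 0 q)).
    by case: (not_mutually_inside gg tg tg' aq aq').
  have i'q1 : inside g' (pt 0 q.+1) = false by rewrite -(inside_along gg aq aq1).
  have [||t [h1 h2 h3 h4]] := @crossing_time (fun t => inside g' (pt 0 t)) q.+1 u.
  - exact: q1u.
  - by rewrite i'q1 iu.
  have [at1 _] : along g' (pt 0 t) /\ along g' (pt 0 t.+1).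
    by apply: cross_along; [exact: ltn_trans hu | rewrite h3 h4 i'q1 iu].
  have e : enclosing (pt 0 t) = enclosing (pt 0 q').
    by apply: along_enclosing at1 aq' _; rewrite h3 i'q1 iq'.
  have /strict : q < t < q' by rewrite h1 -eu ltnW.
  by rewrite eqd /depth e eqxx.
have igu : inside g (pt 0 u) = false.
  by rewrite (inside_along (g := g') _ au aq') // eq_sym.
have [||t [h1 h2 h3 h4]] := @crossing_time (fun t => inside g (pt 0 t)) q.+1 u.
- exact: q1u.
- by rewrite ig1 igu.
have [_ at1] : along g (pt 0 t) /\ along g (pt 0 t.+1).
  by apply: cross_along; [exact: ltn_trans hu | rewrite h3 h4 ig1 igu].
have e : enclosing (pt 0 t.+1) = enclosing (pt 0 q).
  by apply: along_enclosing at1 aq _; rewrite h4 igu ig.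
have /strict : q < t.+1 < q' by rewrite ltnS ltnW // -eu ltnS.
by rewrite /depth e eqxx.
Qed.

(** Cut the interval into [M] parts: either the least possible value [d] occurs
    in each of them, or some part avoids it and has one value fewer. *)
Lemma frequent_minimum (f : nat -> nat) (M N d a : nat) :
  (forall i, a <= i < a + M ^ N -> d <= f i < d + N) ->
  exists b c e, [/\ a <= b, c <= a + M ^ N,
    forall i, b <= i < c -> e <= f i &
    M <= count (fun i => f i == e) (index_iota b c)].
Proof.
elim: N d a => [|N IH] d a hf.
  by have := hf a; rewrite expn0 addn0; lia.
set w := M ^ N in IH *.
have [h|h] := leqP M (count (fun i => f i == d) (index_iota a (a + M * w))).
  exists a, (a + M * w), d; rewrite expnS; split=> // i hi.
  by move: hi; rewrite -expnS => /hf/andP[].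
have [b bM hb] : exists2 b, b < M & forall i, a + b * w <= i < a + b.+1 * w -> f i != d.
  case: (boolP (has (fun b => all (fun i => f i != d)
      (index_iota (a + b * w) (a + b.+1 * w))) (iota 0 M))).
    case/hasP=> b; rewrite mem_iota /= => bM /allP hb; exists b => // i hi.
    by apply: hb; rewrite mem_index_iota.
  move/hasPn => hno; exfalso.
  suff : forall c, c <= M -> c <= count (fun i => f i == d) (index_iota a (a + c * w)).
    by move/(_ M (leqnn _)); rewrite leqNgt h.
  elim=> // c IHc hc.
  have -> : index_iota a (a + c.+1 * w) =
      index_iota a (a + c * w) ++ index_iota (a + c * w) (a + c.+1 * w).
    rewrite /index_iota -[X in _ ++ iota X _]/(a + c * w).
    have -> : a + c.+1 * w - a = (a + c * w - a) + (a + c.+1 * w - (a + c * w)).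
      by rewrite mulSn; lia.
    by rewrite iotaD; congr (_ ++ iota _ _); lia.
  rewrite count_cat -[X in X <= _]addn1 leq_add //; first by apply: IHc; apply: ltnW.
  have := hno c; rewrite mem_iota /= hc => /(_ isT) /allPn[i hi /negbNE fi].
  by rewrite -has_count; apply/hasP; exists i.
have bw : b.+1 * w <= M * w by rewrite leq_mul2r bM orbT.
have [i hi|b' [c [e [h1 h2 h3 h4]]]] := IH d.+1 (a + b * w).
  have := hf i; have := hb i; rewrite expnS -/w; move: bw hi; rewrite mulSn; lia.
exists b', c, e; split=> //; first by apply: leq_trans h1; rewrite leq_addr.
by apply: leq_trans h2 _; rewrite expnS -/w; move: bw; rewrite mulSn; lia.
Qed.

(** At the [M] places where the depth takes its frequent minimum, [same_depth_related]
    applies to each pair. *)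
Theorem related_top_locs M : M ^ n.+1 <= m.+1 -> exists l : seq nat,
  [/\ uniq l, M <= size l, all (fun j => j <= m) l &
      {in l &, forall i j, i <= j -> E (pt 0 i) (pt 0 j)}].
Proof.
move=> hM; have [i hi|b [c [e [_ hc hmin hcount]]]] := @frequent_minimum depth M n.+1 0 0.
  by rewrite leq0n add0n ltnS card_enclosing //; lia.
exists [seq i <- index_iota b c | depth i == e]; split.
- by rewrite filter_uniq // iota_uniq.
- by rewrite size_filter.
- by apply/allP => j; rewrite mem_filter mem_index_iota; lia.
move=> i j; rewrite !mem_filter !mem_index_iota => /andP[/eqP di hi] /andP[/eqP dj hj] ij.
apply: same_depth_related => //; first by lia.
  by rewrite di dj.
by move=> t ht; rewrite di; apply: hmin; lia.
Qed.
End SameSide.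
End Grid.

(** * Homogeneous layouts *)

Lemma flip_range j : 0 < j < 6 -> 0 < 6 - j < 6. Proof. lia. Qed.

(** The situation after the use of Ramsey's theorem: [v s j] is the vertex of
    column [j] over the tree node given by the increasing word [s], and the
    order of vertices and the colours of edges depend only on locations,
    through [before], [loc_colour], [root_before] and [root_colour]. *)
Section Canonical.
Variables (n m : nat) (C : finType) (X : eqType).
Local Notation loc := (loc n m).
Variables (v : seq nat -> 'I_m.+1 -> X) (lt adj : rel X) (clr : X -> X -> C).

Hypothesis lt_irr : irreflexive lt.
Hypothesis lt_trans : transitive lt.
Hypothesis lt_total : forall x y, x != y -> lt x y || lt y x.
Hypothesis adjC : symmetric adj.
Hypothesis clrC : forall x y, clr x y = clr y x.
Hypothesis nocross : forall a b c d, adj a b -> adj c d -> clr a b = clr c d ->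
  lt a c -> lt c b -> lt b d -> False.

(** The alphabet consists of seven blocks of [n.+1] letters: five for sibling
    branches, one below and one above all of them. *)
Definition word (s : seq nat) := sorted ltn s && all (ltn^~ (7 * n.+1)) s.
Definition full_word (s : seq nat) := word s && (size s == n.+1).
(** Two full branches with the same first [h] letters, after which all letters
    of [s] are below all letters of [s']. *)
Definition branch (h : nat) (s s' : seq nat) :=
  [&& full_word s, full_word s', take h s == take h s' & allrel ltn (drop h s) (drop h s')].
Definition vertex_at (s : seq nat) (p : loc) := v (take p.1.+1 s) p.2.

Hypothesis v_inj : forall s s' j j', word s -> word s' -> v s j = v s' j' -> s = s' /\ j = j'.
Hypothesis adj_leg : forall s (p q : loc), full_word s ->
  loc_adj p q -> adj (vertex_at s p) (vertex_at s q).
Hypothesis adj_root : forall s j, full_word s -> adj (v [::] j) (vertex_at s (ord0, j)).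

Variables (before : nat -> loc -> loc -> bool) (loc_colour : loc -> loc -> C).
Variables (root_before : 'I_m.+1 -> loc -> bool) (root_colour : 'I_m.+1 -> C).
Hypothesis beforeE : forall h s s' (p q : loc), branch h s s' -> h <= p.1 -> h <= q.1 ->
  lt (vertex_at s p) (vertex_at s' q) = before h p q.
Hypothesis loc_colourE : forall s (p q : loc), full_word s ->
  clr (vertex_at s p) (vertex_at s q) = loc_colour p q.
Hypothesis root_beforeE : forall s j (p : loc), full_word s ->
  lt (v [::] j) (vertex_at s p) = root_before j p.
Hypothesis root_colourE : forall s j, full_word s ->
  clr (v [::] j) (vertex_at s (ord0, j)) = root_colour j.

Lemma lt_asym x y : lt x y -> lt y x -> False.
Proof. by move=> h1 h2; have := lt_trans h1 h2; rewrite lt_irr. Qed.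

Lemma ltN x y : x != y -> lt y x = ~~ lt x y.
Proof.
move/lt_total; case xy: (lt x y); case yx: (lt y x) => // _.
by case: (lt_asym xy yx).
Qed.

Lemma word_take s t : word s -> word (take t s).
Proof.
case/andP=> h1 h2; rewrite /word take_sorted //=.
by apply/allP => x /mem_take; apply: (allP h2).
Qed.

Lemma beforeNE h s s' (p q : loc) : branch h s s' -> h <= p.1 -> h <= q.1 ->
  lt (vertex_at s' q) (vertex_at s p) = ~~ before h p q.
Proof.
move=> b hp hq; rewrite -(beforeE b hp hq); apply: ltN; apply/eqP.
move: b => /and4P[/andP[gs /eqP ss] /andP[gs' /eqP ss'] _ /allrelP b].
case/(v_inj (word_take _ gs) (word_take _ gs')) => e _.
have hn : h < n.+1 by apply: leq_ltn_trans hp (ltn_ord _).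
have := congr1 (fun l => nth 0 l h) e; rewrite !nth_take // => en.
have mem l : size l = n.+1 -> nth 0 l h \in drop h l.
  by move=> sl; rewrite -[X in nth _ _ X](addn0 h) -nth_drop mem_nth // size_drop subn_gt0 sl.
have : nth 0 s h < nth 0 s' h by apply: b; apply: mem.
by rewrite en ltnn.
Qed.

Lemma size_take_leg s (p : loc) : full_word s -> size (take p.1.+1 s) = p.1.+1.
Proof. by case/andP=> _ /eqP ss; rewrite size_takel // ss. Qed.

(** The branch with its first [h] letters in block 1 and the others in block [i]. *)
Definition leg (h i : nat) := mkseq (fun t => (if t < h then 1 else i) * n.+1 + t) n.+1.

Lemma leg_full h i : 0 < i \/ h = 0 -> i < 7 -> full_word (leg h i).
Proof.
move=> hi i7; rewrite /full_word size_mkseq eqxx andbT /word; apply/andP; split.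
  apply: (@homo_sorted _ _ _ ltn ltn); last exact: iota_ltn_sorted.
  move=> a b; rewrite /= => ab; case: hi => [hi|->]; last by rewrite /= ltn_add2l.
  by case: (ltnP a h) => ah; case: (ltnP b h) => bh; nia.
apply/allP => x /mapP[t]; rewrite mem_iota => /andP[_ ht] ->.
rewrite add0n in ht; case: (ltnP t h) => _ /=; first by lia.
by apply: (@leq_trans (i.+1 * n.+1)); [rewrite mulSn addnC ltn_add2r | rewrite leq_mul2r i7 orbT].
Qed.

Lemma leg_branch h i j : 0 < i \/ h = 0 -> i < j -> j < 7 -> branch h (leg h i) (leg h j).
Proof.
move=> hi ij j7; rewrite /branch !leg_full //; try lia.
rewrite /= /leg /mkseq -!map_take -!map_drop take_iota drop_iota; apply/andP; split.
  apply/eqP/eq_in_map => t; rewrite mem_iota => ht.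
  by have -> : t < h by lia.
apply/allrelP => x y /mapP[t]; rewrite mem_iota => ht -> /mapP[t']; rewrite mem_iota => ht' ->.
have -> : t < h = false by lia.
have -> : t' < h = false by lia.
nia.
Qed.

(** There is room for a branch below and for a branch above [x]. *)
Definition central (x : seq nat) := branch 0 (leg 0 0) x && branch 0 x (leg 0 6).

Lemma leg_central h i : 0 < i < 6 -> central (leg h i).
Proof.
move=> hi; rewrite /central /branch !take0 !drop0 !eqxx /= !leg_full //; try lia.
apply/andP; split; apply/allrelP => x y /mapP[t]; rewrite mem_iota => ht -> /mapP[t'];
  rewrite mem_iota => ht' ->.
  by case: (ltnP t' h) => _ /=; nia.
by case: (ltnP t h) => _ /=; nia.
Qed.

Lemma central_full x : central x -> full_word x.
Proof. by case/andP=> /and4P[_ ->]. Qed.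

(** Two copies of one grid edge have the same colour, hence do not cross. *)
Lemma no_crossing_copies s s' p q : full_word s -> full_word s' -> loc_adj p q ->
  lt (vertex_at s p) (vertex_at s' p) -> lt (vertex_at s' p) (vertex_at s q) ->
  lt (vertex_at s q) (vertex_at s' q) -> False.
Proof.
move=> ls ls' pq; apply: nocross; rewrite ?adj_leg //.
by rewrite !loc_colourE.
Qed.

(** For branches splitting at level [h], the copies of [p] and [q] are
    interleaved, in one common direction; otherwise all copies of one of the
    two locations precede the copies of the other one in different branches. *)
Definition eqv (h : nat) (p q : loc) : Prop := before h p q = before h q p.

Section Branch.
Variable h : nat.
Let br i j : i < j -> 0 < i -> j < 7 -> branch h (leg h i) (leg h j).
Proof. by move=> ij i0 j7; apply: leg_branch => //; left. Qed.
Let ll i : 0 < i -> i < 7 -> full_word (leg h i).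
Proof. by move=> i0 i7; apply: leg_full => //; left. Qed.

Lemma eqv_sign (p q : loc) : h <= p.1 -> h <= q.1 -> eqv h p q -> before h p p = before h p q.
Proof.
rewrite /eqv => hp hq e; case r: (before h p q); rewrite r in e.
  rewrite -(beforeE (@br 1 3 _ _ _)) //; apply: (@lt_trans (vertex_at (leg h 2) q)).
    by rewrite (beforeE (@br 1 2 _ _ _)).
  by rewrite (beforeE (@br 2 3 _ _ _)) // -e.
apply: negbTE; rewrite -(beforeNE (@br 1 3 _ _ _)) //; apply: (@lt_trans (vertex_at (leg h 2) q)).
  by rewrite (beforeNE (@br 2 3 _ _ _)) // -e.
by rewrite (beforeNE (@br 1 2 _ _ _)) // r.
Qed.

Lemma eqv_trans (p q o : loc) : h <= p.1 -> h <= q.1 -> h <= o.1 ->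
  eqv h p q -> eqv h q o -> eqv h p o.
Proof.
move=> hp hq ho pq qo.
have [s1 s2] : before h q q = before h p q /\ before h q q = before h q o.
  by split; [rewrite pq|]; apply: eqv_sign => //; rewrite /eqv pq.
have mono (a b c : loc) : h <= a.1 -> h <= b.1 -> h <= c.1 ->
    before h a b = before h q q -> before h b c = before h q q ->
    before h a c = before h q q.
  move=> ha hb hc e1 e2; case r: (before h q q); rewrite r in e1 e2.
    rewrite -(beforeE (@br 1 3 _ _ _)) //; apply: (@lt_trans (vertex_at (leg h 2) b)).
      by rewrite (beforeE (@br 1 2 _ _ _)).
    by rewrite (beforeE (@br 2 3 _ _ _)).
  apply: negbTE; rewrite -(beforeNE (@br 1 3 _ _ _)) //; apply: (@lt_trans (vertex_at (leg h 2) b)).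
    by rewrite (beforeNE (@br 2 3 _ _ _)) // e2.
  by rewrite (beforeNE (@br 1 2 _ _ _)) // e1.
by rewrite /eqv (mono p q o) // (mono o q p) // -?qo -?pq.
Qed.

(** If all copies of [p] preceded those of [q] with the same direction, then two
    copies of the edge [p q] would cross. *)
Lemma eqv_adj (p q : loc) : h <= p.1 -> h <= q.1 -> loc_adj p q ->
  before h p p = before h q q -> eqv h p q.
Proof.
move=> hp hq pq; have qp : loc_adj q p by rewrite loc_adjC.
rewrite /eqv; case pp: (before h p p) => /esym qq; case rpq: (before h p q); case rqp: (before h q p) => //;
  exfalso.
- apply: (@no_crossing_copies (leg h 1) (leg h 2) p q); rewrite ?ll // ?(beforeE (@br 1 2 _ _ _)) //.
  by rewrite (beforeNE (@br 1 2 _ _ _)) // rqp.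
- apply: (@no_crossing_copies (leg h 1) (leg h 2) q p); rewrite ?ll // ?(beforeE (@br 1 2 _ _ _)) //.
  by rewrite (beforeNE (@br 1 2 _ _ _)) // rpq.
- apply: (@no_crossing_copies (leg h 2) (leg h 1) p q); rewrite ?ll // ?(beforeNE (@br 1 2 _ _ _)) ?pp ?qq //.
  by rewrite (beforeE (@br 1 2 _ _ _)).
- apply: (@no_crossing_copies (leg h 2) (leg h 1) q p); rewrite ?ll // ?(beforeNE (@br 1 2 _ _ _)) ?pp ?qq //.
  by rewrite (beforeE (@br 1 2 _ _ _)).
Qed.
End Branch.

(** The comparison extends from separated branches to arbitrary ones by passing
    through a branch above, or below, both. *)
Lemma separated p q : before 0 p q -> before 0 q p = false ->
  forall x y, central x -> central y -> lt (vertex_at x p) (vertex_at y q).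
Proof.
move=> pq qp x y /andP[lx xh] /andP[ly yh].
case pp: (before 0 p p).
  apply: (@lt_trans (vertex_at (leg 0 6) p)); first by rewrite (beforeE xh).
  by rewrite (beforeNE yh) // qp.
apply: (@lt_trans (vertex_at (leg 0 0) p)); first by rewrite (beforeNE lx) // pp.
by rewrite (beforeE ly).
Qed.

(** Once all copies of [p] precede those of [q], parallel copies of the edge [p q]
    must be nested, at whichever level [h] the branches split. *)
Lemma separated_opposite h (p q : loc) : before 0 p q -> before 0 q p = false ->
  h <= p.1 -> h <= q.1 ->
  loc_adj p q -> before h p p != before h q q.
Proof.
move=> pq qp hp hq adjpq; apply/eqP => e.
have sep := separated pq qp.
have br : branch h (leg h 1) (leg h 2) by apply: leg_branch => //; left.
have [m1 m2] : central (leg h 1) /\ central (leg h 2) by split; apply: leg_central.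
have [l1 l2] : full_word (leg h 1) /\ full_word (leg h 2) by split; apply: central_full.
case pp: (before h p p); rewrite pp in e.
  apply: (no_crossing_copies l1 l2 adjpq); [| exact: sep |]; by rewrite (beforeE br) // -e.
apply: (no_crossing_copies l2 l1 adjpq); [| exact: sep |]; by rewrite (beforeNE br) // -?e ?pp.
Qed.

Definition increasing (p : loc) := before 0 p p.

Lemma opposite_separates (e : edge n m) : opposite increasing e ->
  before 0 e.1 e.2 != before 0 e.2 e.1.
Proof.
case: e => p q /and3P[/= _ sp sq]; apply/eqP => e.
have e1 := @eqv_sign 0 p q (leq0n _) (leq0n _) e.
have e2 := @eqv_sign 0 q p (leq0n _) (leq0n _) (esym e).
by move: sp sq; rewrite /increasing e1 e2 e => ->.
Qed.

(** This is what lets one follow a wall downwards: although walls are defined by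
    branches splitting at the root, they remain walls for every lower level. *)
Lemma opposite_persists h (e : edge n m) : opposite increasing e -> h <= e.1.1 -> h <= e.2.1 ->
  before h e.1 e.1 != before h e.2 e.2.
Proof.
move=> oe; have ne := opposite_separates oe; have adje := andP oe.
case: e {oe} ne adje => p q /= ne [adjpq _] hp hq.
case r: (before 0 p q); case r': (before 0 q p); rewrite ?r ?r' // in ne.
  exact: separated_opposite r r' _ _ _.
by rewrite eq_sym; apply: separated_opposite r' r _ _ _; rewrite // loc_adjC.
Qed.

Lemma root_before_eqv j p q : eqv 0 p q -> root_before j p = root_before j q.
Proof.
move=> e; suff H a b : eqv 0 a b -> root_before j a -> root_before j b.
  by apply/idP/idP; apply: H; rewrite // /eqv e.
move=> {}e; have b12 : branch 0 (leg 0 1) (leg 0 2) by apply: leg_branch => //; left.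
have [l1 l2] : full_word (leg 0 1) /\ full_word (leg 0 2) by case/and4P: b12.
case r: (before 0 a b) => ja.
  rewrite -(root_beforeE _ _ l2); apply: (@lt_trans (vertex_at (leg 0 1) a)).
    by rewrite root_beforeE.
  by rewrite (beforeE b12).
rewrite -(root_beforeE _ _ l1); apply: (@lt_trans (vertex_at (leg 0 2) a)).
  by rewrite root_beforeE.
by rewrite (beforeNE b12) // -e r.
Qed.

Lemma root_neq j s p : full_word s -> v [::] j != vertex_at s p.
Proof.
case/andP=> gs /eqP ss; apply/eqP => /v_inj e.
have [/(congr1 size) + _] := e isT (word_take _ gs).
by rewrite size_take ss; case: ifP.
Qed.

(** Among equivalent locations of the top row, two are joined to root copies by
    edges of the same colour and on the same side of the class.  Since the class
    is interleaved, copies can be chosen in either order on two branches, one of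
    which makes these edges cross. *)
Lemma top_class_bound (J : seq 'I_m.+1) : uniq J -> #|{: bool * C}| < size J ->
  {in J &, forall j j', eqv 0 (ord0, j) (ord0, j')} -> False.
Proof.
move=> uJ szJ hJ.
case: J uJ szJ hJ => [|j0 J'] //; set J := _ :: _ => uJ szJ hJ.
pose f (j : 'I_m.+1) := (root_before j (ord0, j), root_colour j).
have : ~~ uniq [seq f j | j <- J].
  apply/negP => /card_uniqP; rewrite size_map => e.
  by move: szJ; rewrite -e ltnNge max_card.
move/(uniqPn (f j0)) => [a [b [ab]]]; rewrite size_map => hb.
rewrite !(nth_map j0) //; last exact: ltn_trans hb.
set j := nth _ _ a; set j' := nth _ _ b => -[eR eC].
have jJ : j \in J by apply/mem_nth/(ltn_trans ab).
have jJ' : j' \in J by apply: mem_nth.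
have jj : j != j' by rewrite nth_uniq // ?(ltn_trans ab hb) // neq_ltn ab.
have b12 : branch 0 (leg 0 1) (leg 0 2) by apply: leg_branch => //; left.
have [l1 l2] : full_word (leg 0 1) /\ full_word (leg 0 2) by case/and4P: b12.
wlog lt_roots : j j' eR eC jJ jJ' jj / lt (v [::] j) (v [::] j').
  move=> H; have : v [::] j != v [::] j'.
    by apply/eqP => /v_inj[] // _ e; rewrite e eqxx in jj.
  case/lt_total/orP => hlt; first exact: (H j j').
  by apply: (H j' j) => //; rewrite eq_sym.
have same_side i i' : i \in J -> i' \in J -> root_before i (ord0, i') = root_before i (ord0, i).
  by move=> iJ iJ'; apply: root_before_eqv; apply: hJ.
have root_edges s s' : full_word s -> full_word s' ->
   lt (vertex_at s (ord0, j)) (vertex_at s' (ord0, j')) -> False.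
  move=> ls ls' lss'; case side: (root_before j (ord0, j)).
    apply: (nocross (adj_root j ls) (adj_root j' ls')); rewrite ?root_colourE //.
    by rewrite root_beforeE // same_side // -eR side.
  apply: (@nocross (vertex_at s (ord0, j)) (v [::] j) (vertex_at s' (ord0, j')) (v [::] j')) => //.
  - by rewrite adjC adj_root.
  - by rewrite adjC adj_root.
  - by rewrite clrC root_colourE // clrC root_colourE.
  - by rewrite ltN ?root_neq // root_beforeE // same_side // side.
have e := hJ _ _ jJ jJ'; case r: (before 0 (ord0, j) (ord0, j')).
  by apply: (root_edges (leg 0 1) (leg 0 2)) => //; rewrite (beforeE b12).
by apply: (root_edges (leg 0 2) (leg 0 1)) => //; rewrite (beforeNE b12) // -e r.
Qed.

(** Whichever of [u] and [u'] comes first, one of the edges [a1 u] and [a3 u]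
    crosses [a' u']. *)
Lemma no_interleaved_siblings a1 a' a3 u u' : adj a1 u -> adj a3 u -> adj a' u' ->
  clr a1 u = clr a' u' -> clr a3 u = clr a' u' -> lt a1 a' -> lt a' a3 -> u != u' ->
  [&& lt a3 u & lt a3 u'] || [&& lt u a1 & lt u' a1] -> False.
Proof.
move=> e1 e3 e' c1 c3 l1 l3 uu; have [f1 f3 f'] : [/\ adj u a1, adj u a3 & adj u' a'].
  by split; rewrite adjC.
have [d1 d3] : clr u' a' = clr u a1 /\ clr u' a' = clr u a3.
  by rewrite !(clrC u) !(clrC u').
case/orP=> /andP[lu lu']; case/lt_total/orP: uu => uu.
- by apply: (nocross e1 e' c1 l1) => //; exact: lt_trans l3 lu.
- by apply: (nocross e' e3 (esym c3) l3).
- by apply: (nocross f1 f' (esym d1) uu).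
- by apply: (nocross f' f3 d3 uu) => //; exact: lt_trans lu l1.
Qed.

Definition side (b : bool) (e : edge n m) : loc := if b then e.1 else e.2.

(** Along a wall and below row [h], two consecutive locations of one side differ in
    direction from their common neighbour on the other side, so they agree. *)
Lemma turn_eqv h (e f : edge n m) b : turn increasing e f ->
  h <= e.1.1 -> h <= e.2.1 -> h <= f.1.1 -> h <= f.2.1 ->
  eqv h (side b e) (side b f).
Proof.
case/and3P=> oe of_ t he1 he2 hf1 hf2.
have te := opposite_persists oe he1 he2; have tf := opposite_persists of_ hf1 hf2.
case/orP: t => /andP[/eqP e12 adj12]; case: b; rewrite /= ?e12 //; apply: eqv_adj => //.
  by move: te tf; rewrite e12; do 3!case: (before h _ _).
by move: te tf; rewrite e12; do 3!case: (before h _ _).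
Qed.

(** A wall that runs from the top row to the bottom row. *)
Section Spanning.
Variables (e0 : edge n m) (l : seq (edge n m)).
Hypothesis turns : path (turn increasing) e0 l.
Hypothesis start : e0.1.1 = 0 :> nat.
Hypothesis stop1 : (last e0 l).1.1 = n :> nat.
Hypothesis stop2 : (last e0 l).2.1 = n :> nat.

Let edge_nth i := nth e0 (e0 :: l) i.
Let turn_nth i : i < size l -> turn increasing (edge_nth i) (edge_nth i.+1).
Proof. by move=> hi; move/(pathP e0): turns => /(_ i hi). Qed.

Lemma loc_adj_row (p q : loc) : loc_adj p q -> p.1 <= q.1.+1.
Proof. by rewrite /loc_adj /loc_arc; lia. Qed.

(** The last edge of the wall that touches rows up to [r] joins rows [r] and
    [r.+1], and it keeps its lower endpoint in the next edge. *)
Lemma last_descent (r : nat) : r < n -> exists ib : nat * bool,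
  let e := edge_nth ib.1 in
  [/\ ib.1 < size l, (side (~~ ib.2) e).1 = r :> nat, (side ib.2 e).1 = r.+1 :> nat,
      side ib.2 (edge_nth ib.1.+1) = side ib.2 e &
      forall j, ib.1 < j <= size l -> r < (edge_nth j).1.1 /\ r < (edge_nth j).2.1].
Proof.
move=> rn; pose low i := (i <= size l) && (((edge_nth i).1.1 <= r) || ((edge_nth i).2.1 <= r)).
have ex : exists i, low i by exists 0; rewrite /low /= /edge_nth /= start.
have bnd i : low i -> i <= size l by case/andP.
case: (ex_maxnP ex bnd) => i /andP[il lo] imax.
have after j : i < j <= size l -> r < (edge_nth j).1.1 /\ r < (edge_nth j).2.1.
  case/andP=> ij jl; have : ~~ low j by apply/negP => /imax; rewrite leqNgt ij.
  by rewrite /low jl /= negb_or -!ltnNge => /andP[].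
have {}il : i < size l.
  rewrite ltn_neqAle il andbT; apply/eqP => e.
  by move: lo; rewrite e /edge_nth -[size l]/(size (e0 :: l)).-1 nth_last /= stop1 stop2; lia.
have [a1 a2] := after i.+1 (introT andP (conj (ltnSn i) il)).
have rows (x y : nat) : r < x -> x <= y.+1 -> (x <= r) || (y <= r) -> y = r /\ x = r.+1 by lia.
have := turn_nth il; case/and3P=> /and3P[adje _ _] _ /orP[] /andP[/eqP ee _].
  rewrite -ee in a1; have [h1 h2] := rows _ _ a1 (loc_adj_row adje) lo.
  by exists (i, true); split.
have adje' : loc_adj (edge_nth i).2 (edge_nth i).1 by rewrite loc_adjC.
rewrite -ee in a2; rewrite orbC in lo; have [h1 h2] := rows _ _ a2 (loc_adj_row adje') lo.
by exists (i, false); split.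
Qed.

(** Were the grid too high, two last descents, from rows [r < r'], would agree in
    side, order of the sides, and colour.  Let [z c] and [z' c'] be these edges,
    and let branches split at the node of [z].  The wall connects [c] to [c']
    below row [r], so the copies of [c] and [c'] interleave among the branches; but
    all copies of [c] are joined to one single copy of [z], on the other side of
    the wall, and then [no_interleaved_siblings] applies. *)
Lemma spanning_wall_bound : n <= #|{: bool * bool * C}|.
Proof.
have [f hf] := @fin_all_exists 'I_n (fun=> (nat * bool)%type) _ (fun r => last_descent (ltn_ord r)).
rewrite leqNgt; apply/negP => hn.
pose c r := side (f r).2 (edge_nth (f r).1); pose z r := side (~~ (f r).2) (edge_nth (f r).1).
pose key r := ((f r).2, before 0 (c r) (z r), loc_colour (c r) (z r)).
have : ~~ injectiveb key.
  apply/negP => /injectiveP /card_codom; rewrite card_ord => e.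
  by move: hn; rewrite -{1}e ltnNge max_card.
case/injectivePn => r [r' rr' ekey].
wlog lrr' : r r' rr' ekey / r < r'.
  move=> H; have [h|h|/val_inj h] := ltngtP r r'; first exact: (H r r').
    by apply: (H r' r); rewrite // eq_sym.
  by rewrite h eqxx in rr'.
have [il zr cr next after] := hf r; have [il' zr' cr' next' after'] := hf r'.
rewrite -/(c r) -/(z r) -/(c r') -/(z r') in zr cr next zr' cr' next'.
case: ekey => eb edir ecol.
set b := (f r).2 in eb next; set i := (f r).1 in il next after.
set i' := (f r').1 in il' next' after'.
have ii' : i < i'.
  rewrite ltnNge leq_eqVlt; apply/negP => /orP[/eqP e|h].
    by move: zr'; rewrite /z -eb -/i' e -/b -[side _ _]/(z r) zr => e'; rewrite e' ltnn in lrr'.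
  have [r1 r2] : r' < (edge_nth i).1.1 /\ r' < (edge_nth i).2.1 by apply: after'; rewrite h ltnW.
  have : r' < (z r).1 by rewrite /z /side; case: ifP.
  by rewrite zr ltnNge ltnW.
pose h := r.+1.
have hc : h <= (c r).1 by rewrite cr.
have hc' : h <= (c r').1 by rewrite cr'; apply: leqW.
have opp j : j < size l -> opposite increasing (edge_nth j) by move=> /turn_nth/and3P[].
have eqvc : eqv h (c r) (c r').
  have chain t : i < t <= i' -> eqv h (side b (edge_nth i.+1)) (side b (edge_nth t)).
    elim: t => // t IH; rewrite ltnS leq_eqVlt => /andP[/orP[/eqP<-|it] ti']; first by [].
    have row j : t <= j <= t.+1 -> r < (edge_nth j).1.1 /\ r < (edge_nth j).2.1.
      case/andP=> tj jt; apply: after; rewrite (leq_trans it tj) /=.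
      exact: leq_trans jt (leq_trans ti' (ltnW il')).
    have [t1 t2] := row t (introT andP (conj (leqnn t) (leqnSn t))).
    have [t3 t4] := row t.+1 (introT andP (conj (leqnSn t) (leqnn _))).
    have [i1 i2] := after i.+1 (introT andP (conj (leqnn _) il)).
    have hside (p : edge n m) : r < p.1.1 -> r < p.2.1 -> h <= (side b p).1 by rewrite /side; case: (b).
    have e1 := IH (introT andP (conj it (ltnW ti'))).
    have e2 := @turn_eqv h (edge_nth t) (edge_nth t.+1) b (turn_nth (leq_trans ti' (ltnW il'))) t1 t2 t3 t4.
    exact: eqv_trans (hside _ i1 i2) (hside _ t1 t2) (hside _ t3 t4) e1 e2.
  have -> : c r = side b (edge_nth i.+1) by rewrite next.
  by rewrite /c -eb; apply: chain; rewrite ii' leqnn.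
have adjcz j bb : j < size l -> loc_adj (side bb (edge_nth j)) (side (~~ bb) (edge_nth j)).
  by move=> /opp/and3P[adje _ _]; case: bb; rewrite // loc_adjC.
have sepcz j bb : j < size l ->
    before 0 (side (~~ bb) (edge_nth j)) (side bb (edge_nth j)) =
    ~~ before 0 (side bb (edge_nth j)) (side (~~ bb) (edge_nth j)).
  move=> /opp/opposite_separates; case: bb => /=; do 2!case: (before 0 _ _) => //.
have br j k : 0 < j -> j < k -> k < 6 -> branch h (leg h j) (leg h k).
  by move=> j0 jk k6; apply: leg_branch; [left | | apply: ltnW].
have md j : 0 < j < 6 -> central (leg h j) by apply: leg_central.
have ll j : 0 < j < 6 -> full_word (leg h j) by move/md/central_full.
have zsame j : 0 < j < 6 -> vertex_at (leg h j) (z r) = vertex_at (leg h 1) (z r).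
  case/andP=> j0 j6; have [->//|j1] := eqVneq j 1.
  have /and4P[_ _ /eqP e _] : branch h (leg h 1) (leg h j).
    by apply: br; rewrite // ltn_neqAle eq_sym j1.
  by rewrite /vertex_at zr e.
pose u := vertex_at (leg h 1) (z r); pose u' := vertex_at (leg h 3) (z r').
(* Reversing the order of the siblings makes the order at c increasing. *)
pose S j := leg h (if before h (c r) (c r') then j else 6 - j).
have S_central j : 0 < j < 6 -> central (S j).
  by move=> hj; apply: md; case: ifP => _ //; apply: flip_range.
have incr (p q : loc) j k : h <= p.1 -> h <= q.1 ->
    before h p q = before h (c r) (c r') -> before h q p = before h (c r) (c r') ->
    0 < j -> j < k -> k < 6 -> lt (vertex_at (S j) p) (vertex_at (S k) q).
  rewrite /S => hp hq epq eqp j0 jk k6; case e: (before h (c r) (c r')).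
    by rewrite (beforeE (br _ _ j0 jk k6)) // epq.
  have b' : branch h (leg h (6 - k)) (leg h (6 - j)).
    by apply: br; rewrite ?subn_gt0 ?ltn_subrL ?j0 // ltn_sub2l // (ltn_trans jk).
  by rewrite (beforeNE b') // eqp e.
have incr1 j k : 0 < j -> j < k -> k < 6 -> lt (vertex_at (S j) (c r)) (vertex_at (S k) (c r')).
  by apply: incr; rewrite // -eqvc.
have incr2 j k : 0 < j -> j < k -> k < 6 -> lt (vertex_at (S j) (c r')) (vertex_at (S k) (c r)).
  by apply: incr; rewrite // -eqvc.
have S3 : S 3 = leg h 3 by rewrite /S; case: ifP.
have edge_u j : 0 < j < 6 -> adj (vertex_at (S j) (c r)) u /\
    clr (vertex_at (S j) (c r)) u = loc_colour (c r) (z r).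
  move=> hj; have lS := central_full (S_central _ hj).
  have -> : u = vertex_at (S j) (z r) by rewrite /S zsame //; case: ifP => _ //; apply: flip_range.
  by rewrite loc_colourE //; split=> //; apply: adj_leg => //; apply: adjcz.
have [a2 k2] := edge_u 2 isT; have [a4 k4] := edge_u 4 isT.
have l3 := ll 3 isT.
apply: (no_interleaved_siblings a2 a4 (a' := vertex_at (S 3) (c r')) (u' := u')).
- by rewrite S3; apply: adj_leg => //; apply: adjcz.
- by rewrite k2 S3 loc_colourE.
- by rewrite k4 S3 loc_colourE.
- exact: incr1.
- exact: incr2.
- apply/eqP => /v_inj[||/(congr1 size) + _].
  + by apply: word_take; case/andP: (ll 1 isT).
  + by apply: word_take; case/andP: l3.
  by rewrite !size_take_leg ?ll // zr zr' => -[e]; rewrite e ltnn in lrr'.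
case D: (before 0 (c r) (z r)).
  have D' : before 0 (c r') (z r') by rewrite -edir.
  have E : before 0 (z r) (c r) = false by rewrite /c /z sepcz // D.
  have E' : before 0 (z r') (c r') = false by rewrite /c /z sepcz // D'.
  apply/orP; left; rewrite (separated D E) //=; try by [apply: S_central | apply: md].
  apply: (@lt_trans (vertex_at (S 5) (c r'))); first exact: incr1.
  by apply: (separated D' E'); [apply: S_central | apply: md].
have D' : before 0 (c r') (z r') = false by rewrite -edir.
have E : before 0 (z r) (c r) by rewrite /c /z sepcz // -/(c r) -/(z r) D.
have E' : before 0 (z r') (c r') by rewrite /c /z sepcz // -/(c r') -/(z r') D'.
apply/orP; right; rewrite (separated E D) //=; try by [apply: S_central | apply: md].
apply: (@lt_trans (vertex_at (S 1) (c r'))); last exact: incr2.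
by apply: (separated E' D'); [apply: md | apply: S_central].
Qed.
End Spanning.

(** The topology of the grid forces one of the two excluded configurations. *)
Theorem no_canonical_layout :
  #|{: bool * bool * C}| < n -> #|{: bool * C}|.+1 ^ n.+1 <= m.+1 -> False.
Proof.
move=> hn hm.
have nospan i j g : i < m -> j < m -> wall increasing (pt n m 0 i) (pt n m 0 i.+1) = Some g ->
    wall increasing (pt n m n j) (pt n m n j.+1) = Some g -> False.
  move=> _ _; rewrite /wall; case: eqP => // _ [<-]; case: eqP => // _ [].
  move/esym/(rootP (sym_connect_sym (turn_sym increasing)))/connectP => [l pl el].
  have := @spanning_wall_bound _ l pl; rewrite -el leqNgt hn => H.
  by have : false by apply: H; case: ifP => _; rewrite /= inordK.
have [|||l [ul szl /allP lm hl]] := @related_top_locs n m increasing (eqv 0) _ _ _ nospan _ hm.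
- by [].
- by move=> p q o; apply: eqv_trans.
- by move=> p q; apply: eqv_adj.
apply: (@top_class_bound (map inord l)); rewrite ?size_map //.
  rewrite map_inj_in_uniq // => i j /lm hi /lm hj /(congr1 val).
  by rewrite /= !inordK.
have i0 : inord 0 = ord0 :> 'I_n.+1 by apply: val_inj; rewrite /= inordK.
move=> _ _ /mapP[i il ->] /mapP[j jl ->]; rewrite -i0.
by case/orP: (leq_total i j) => ij; [|symmetry]; apply: hl.
Qed.
End Canonical.

(** * From a layout to a homogeneous one *)

Lemma node_take_parent D s r : sorted ltn s -> all (ltn^~ D) s -> r < size s ->
  @parent (subset_tree D) (node D (take r.+1 s)) (node D (take r s)).
Proof.
move=> ss /allP sD hr; rewrite (take_nth 0 hr); apply: node_parent.
  by apply: sD; apply: mem_nth.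
move: ss; rewrite -{1}(cat_take_drop r s) (drop_nth 0 hr) (sorted_pairwise ltn_trans).
by rewrite pairwise_cat allrel_consr => /and3P[/andP[]].
Qed.

Lemma has_stack_layout_widen (G : sgraph) k k' :
  k <= k' -> has_stack_layout G k -> has_stack_layout G k'.
Proof.
move=> kk [L [phi [lin ncr]]]; exists L, (fun e => widen_ord kk (phi e)).
by split=> // e f /(congr1 val) /= h; apply: ncr; apply: val_inj.
Qed.


Lemma subseq_map_nth (M l : seq nat) : sorted ltn l -> all (ltn^~ (size M)) l ->
  subseq (map (nth 0 M) l) M.
Proof.
move=> sl /allP lM; rewrite -[X in subseq _ X](mkseq_nth 0 M) /mkseq.
apply: map_subseq.
have -> : l = [seq i <- iota 0 (size M) | i \in l].
  apply: (irr_sorted_eq ltn_trans ltnn) => //.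
    by apply: sorted_filter; [exact: ltn_trans | exact: iota_ltn_sorted].
  move=> i; rewrite mem_filter mem_iota /= add0n.
  by case il: (i \in l) => //; have /= -> := lM _ il.
exact: filter_subseq.
Qed.

Section FromLayout.
Variables (n m k D : nat).
Let G := tree_path_graph (subset_tree D) m.+1.
Variables (L : rel G) (phi : {e : {set G} | e \in edges G} -> 'I_k).
Hypothesis layout : stack_layout L phi.
Let N := n.+1.
Let V : finType := loc n m.
Let C : finType := option 'I_k.

Definition colour (x y : G) : C := omap phi (insub [set x; y]).
Definition copy (s : seq nat) (j : 'I_m.+1) : G := (node D s, j).
Definition copy_at (s : seq nat) (p : V) : G := copy (take p.1.+1 s) p.2.

(** The part of a layout that is visible on a list of [2 * n.+1] indices. *)
Definition pattern : finType :=
  ({ffun 'I_n.+2 * V * V -> bool} * {ffun V * V -> C} *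
   {ffun 'I_m.+1 * V -> bool} * {ffun 'I_m.+1 -> C})%type.

(** The list is read as a branch followed by the tail of another one, which shares
    the first [t.1.1] entries of the first branch. *)
Definition pattern_of (l : seq nat) : pattern :=
  ([ffun t : 'I_n.+2 * V * V => strict L (copy_at l t.1.2)
      (copy_at (take t.1.1 l ++ drop N l) t.2)],
   [ffun t : V * V => colour (copy_at l t.1) (copy_at l t.2)],
   [ffun t : 'I_m.+1 * V => strict L (copy [::] t.1) (copy_at l t.2)],
   [ffun j => colour (copy [::] j) (copy_at l (ord0, j))]).

Variables (M : seq nat) (kappa : pattern).
Hypothesis M_sorted : sorted ltn M.
Hypothesis M_bound : all (ltn^~ D) M.
Hypothesis M_size : size M = 8 * N.
Hypothesis M_homogeneous : homogeneous (2 * N) pattern_of M kappa.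

Let v (s : seq nat) := copy (map (nth 0 M) s).

Lemma strict_irr : irreflexive (strict L).
Proof. by move=> x; rewrite /strict eqxx. Qed.

Lemma strict_trans : transitive (strict L).
Proof.
case: layout => [[_ asym tr _] _] y x z /andP[xy lxy] /andP[yz lyz].
rewrite /strict (tr _ _ _ lxy lyz) andbT; apply: contraNneq xy => e.
by apply/eqP/asym; rewrite lxy e.
Qed.

Lemma strict_total x y : x != y -> strict L x y || strict L y x.
Proof.
by case: layout => [[_ _ _ tot] _] xy; rewrite /strict xy eq_sym xy; apply: tot.
Qed.

Lemma colourC x y : colour x y = colour y x.
Proof. by rewrite /colour setUC. Qed.

Lemma adj_edge x y : @adj G x y -> [set x; y] \in edges G.
Proof. by move=> h; apply/imsetP; exists (x, y) => //; rewrite inE. Qed.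

Lemma layout_no_cross a b c d : @adj G a b -> @adj G c d -> colour a b = colour c d ->
  strict L a c -> strict L c b -> strict L b d -> False.
Proof.
move=> ab cd; rewrite /colour !insubT ?adj_edge // => hab hcd [e] ac cb bd.
case: layout => _ /(_ _ _ e); apply; split=> /=; last first.
  exists a, b, c, d; rewrite ac cb bd; split=> //.
    exact: strict_trans ac cb.
  exact: strict_trans cb bd.
have ad := strict_trans ac (strict_trans cb bd).
rewrite -setI_eq0; apply/eqP/setP => x; rewrite !inE.
apply/negP => /andP[/orP[]/eqP-> /orP[]/eqP h].
- by rewrite h strict_irr in ac.
- by rewrite h strict_irr in ad.
- by rewrite h strict_irr in cb.
- by rewrite h strict_irr in bd.
Qed.

Lemma map_nth_word s : word n s -> sorted ltn (map (nth 0 M) s) /\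
  all (ltn^~ D) (map (nth 0 M) s).
Proof.
case/andP=> ss /allP sb; have sub : subseq (map (nth 0 M) s) M.
  apply: subseq_map_nth => //; apply/allP => i /sb; rewrite M_size /= => h.
  by apply: leq_trans h _; rewrite leq_mul2r orbT.
split; first exact: (@subseq_sorted _ ltn ltn_trans _ _ sub M_sorted).
by apply/allP => x /(mem_subseq sub); apply: (allP M_bound).
Qed.

Lemma v_injective s s' j j' : word n s -> word n s' -> v s j = v s' j' -> s = s' /\ j = j'.
Proof.
move=> gs gs' [e ->]; split=> //.
have [s1 s2] := map_nth_word gs; have [s1' s2'] := map_nth_word gs'.
have {}e := node_inj s1 s1' s2 s2' e.
have uM : uniq M := sorted_uniq ltn_trans ltnn M_sorted.
have inv t : word n t -> map (index^~ M) (map (nth 0 M) t) = t.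
  case/andP=> _ /allP tb; rewrite -map_comp; apply: map_id_in => i /tb /= h.
  by apply: index_uniq => //; rewrite M_size; apply: leq_trans h _; rewrite leq_mul2r orbT.
by rewrite -(inv s) // e inv.
Qed.

Lemma v_adj_leg s (p q : V) : full_word n s -> loc_adj p q -> @adj G (vertex_at v s p) (vertex_at v s q).
Proof.
move=> /andP[gs /eqP ss]; have [s1 s2] := map_nth_word gs.
have par (a b : V) : b.1 = a.1.+1 :> nat ->
    @parent (subset_tree D) (vertex_at v s b).1 (vertex_at v s a).1.
  move=> e; rewrite /vertex_at /v /= e !map_take; apply: node_take_parent => //.
  by rewrite size_map ss -e ltn_ord.
have arc (a b : V) : loc_arc a b -> tp_adj (vertex_at v s a) (vertex_at v s b).
  case/or3P=> /andP[/eqP e1 /eqP e2]; apply/orP.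
  - by left; apply/or3P; constructor 3; rewrite /horizontal /vertex_at /= e1 e2 !eqxx.
  - by right; apply/or3P; constructor 1; rewrite /vertical par //= -val_eqE /= e2.
  - by right; apply/or3P; constructor 2; rewrite /diagonal par //= e2.
by case/orP=> [/arc|/arc]; rewrite // tp_adj_sym.
Qed.

Lemma v_adj_root s j : full_word n s -> @adj G (v [::] j) (vertex_at (n := n) v s (ord0, j)).
Proof.
move=> /andP[gs /eqP ss]; have [s1 s2] := map_nth_word gs.
apply/orP; right; apply/or3P; constructor 1; rewrite /vertical /= eqxx andbT.
have := @node_take_parent D _ 0 s1 s2; rewrite size_map ss take0 => /(_ isT).
by rewrite map_take.
Qed.

Lemma pattern_const l : sorted ltn l -> all (ltn^~ (8 * N)) l -> size l = 2 * N ->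
  pattern_of (map (nth 0 M) l) = kappa.
Proof.
move=> sl bl szl; apply: M_homogeneous; last by rewrite size_map.
by apply: subseq_map_nth; rewrite ?M_size.
Qed.

Lemma copy_at_take s t (p : V) : N <= size s -> copy_at (s ++ t) p = copy_at s p.
Proof.
move=> hs; rewrite /copy_at takel_cat //; apply: leq_trans hs; exact: ltn_ord.
Qed.

Lemma v_copy_at s p : vertex_at v s p = copy_at (map (nth 0 M) s) p.
Proof. by rewrite /vertex_at /v map_take. Qed.

Lemma allrel_iota s a b : all (ltn^~ a) s -> allrel ltn s (iota a b).
Proof.
by move/allP => h; apply/allrelP => x y /h /= xa; rewrite mem_iota => /andP[/(leq_trans xa)].
Qed.

(** The union of the two branches has fewer than [2 * n.+1] letters if [0 < h]; it
    is completed by letters from the eighth block, above all words in use. *)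
Lemma v_order h s s' (p q : V) : branch n h s s' -> h <= p.1 -> h <= q.1 ->
  strict L (vertex_at v s p) (vertex_at v s' q) = kappa.1.1.1 (inord h, p, q).
Proof.
move=> /and4P[/andP[/andP[ss sb] /eqP sz] /andP[/andP[ss' sb'] /eqP sz'] /eqP e hall] hp _.
have hN : h < N := leq_ltn_trans hp (ltn_ord _).
rewrite !(sorted_pairwise ltn_trans) in ss ss'.
pose pad := iota (7 * N) h; pose l := s ++ drop h s' ++ pad.
move: ss'; rewrite -{1}(cat_take_drop h s') pairwise_cat => /and3P[htd _ hd].
have bd : all (ltn^~ (7 * N)) (drop h s').
  by apply/allP => x /mem_drop; apply: (allP sb').
rewrite -(@pattern_const l); first last.
- by rewrite !size_cat size_drop size_iota sz sz' /N; lia.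
- have w7 x : x < 7 * N -> x < 8 * N by move/leq_trans; apply; rewrite leq_mul2r orbT.
  rewrite !all_cat; apply/and3P; split.
  + by apply: sub_all sb => x; apply: w7.
  + by apply: sub_all bd => x; apply: w7.
  + by apply/allP => x; rewrite mem_iota /=; move: hN; rewrite /N; lia.
- rewrite (sorted_pairwise ltn_trans) !pairwise_cat ss hd allrel_catr.
  rewrite !allrel_iota // -{1}(cat_take_drop h s) allrel_catl e htd hall /=.
  by rewrite -(sorted_pairwise ltn_trans) iota_ltn_sorted.
rewrite /pattern_of /= ffunE /= inordK; last exact: leqW.
have fs : size (map (nth 0 M) s) = N by rewrite size_map.
rewrite /l map_cat copy_at_take ?fs // v_copy_at; congr (strict L _ _).
rewrite takel_cat ?fs ?(ltnW hN) // drop_size_cat // v_copy_at.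
rewrite -map_take e -map_cat catA cat_take_drop map_cat copy_at_take //.
by rewrite size_map sz'.
Qed.

Lemma v_leg_pattern s : full_word n s -> exists t,
  pattern_of (map (nth 0 M) s ++ t) = kappa /\ size (map (nth 0 M) s) = N.
Proof.
case/andP=> /andP[ss sb] /eqP sz; exists (map (nth 0 M) (iota (7 * N) N)).
rewrite size_map sz; split=> //; rewrite -map_cat; apply: pattern_const.
- rewrite (sorted_pairwise ltn_trans) !pairwise_cat allrel_iota //.
  by rewrite -!(sorted_pairwise ltn_trans) ss iota_ltn_sorted.
- rewrite all_cat; apply/andP; split; apply/allP => x; last by rewrite mem_iota /= /N; lia.
  by move/(allP sb)/leq_trans; apply; rewrite leq_mul2r orbT.
- by rewrite size_cat size_iota sz /N; lia.
Qed.

Lemma v_colour s (p q : V) : full_word n s ->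
  colour (vertex_at v s p) (vertex_at v s q) = kappa.1.1.2 (p, q).
Proof.
by case/v_leg_pattern=> t [<- sz]; rewrite /= ffunE /= !copy_at_take ?sz // !v_copy_at.
Qed.

Lemma v_root_order s j (p : V) : full_word n s ->
  strict L (v [::] j) (vertex_at v s p) = kappa.1.2 (j, p).
Proof.
by case/v_leg_pattern=> t [<- sz]; rewrite /= ffunE /= copy_at_take ?sz // v_copy_at.
Qed.

Lemma v_root_colour s j : full_word n s ->
  colour (v [::] j) (vertex_at (n := n) v s (ord0, j)) = kappa.2 j.
Proof.
by case/v_leg_pattern=> t [<- sz]; rewrite /= ffunE /= copy_at_take ?sz // v_copy_at.
Qed.

Lemma no_homogeneous_layout :
  #|{: bool * bool * C}| < n -> #|{: bool * C}|.+1 ^ n.+1 <= m.+1 -> False.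
Proof.
apply: (@no_canonical_layout n m C G v (strict L) (@adj G) colour
  strict_irr strict_trans strict_total (@adj_sym G) colourC layout_no_cross v_injective
  v_adj_leg v_adj_root (fun h p q => kappa.1.1.1 (inord h, p, q))
  (fun p q => kappa.1.1.2 (p, q)) (fun j p => kappa.1.2 (j, p)) (fun j => kappa.2 j)
  v_order v_colour v_root_order v_root_colour).
Qed.
End FromLayout.


Theorem theorem1p6 :
  forall s : nat, exists (T : rooted_tree) (m : nat),
    0 < m /\ s < stack_number (tree_path_graph T m).
Proof.
move=> k.
pose n := #|{: bool * bool * option 'I_k}|.+1.
pose m := #|{: bool * option 'I_k}|.+1 ^ n.+1.
have [D hD] := ramsey (pattern n m k) (2 * n.+1) (8 * n.+1).
exists (subset_tree D), m.+1; split=> //; rewrite ltnNge; apply/negP => le.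
have : has_stack_layout (tree_path_graph (subset_tree D) m.+1) k.
  apply: has_stack_layout_widen le _.
  by rewrite /stack_number; case: ex_minnP => j /asboolP.
case=> L [phi lay].
have [|M [kappa [sM szM hM]]] := hD _ (@pattern_of n m k D L phi) (iota 0 D).
  by rewrite size_iota.
apply: (no_homogeneous_layout lay _ _ szM hM) => //.
- exact: (@subseq_sorted _ ltn ltn_trans _ _ sM (iota_ltn_sorted _ _)).
- by apply/allP => x /(mem_subseq sM); rewrite mem_iota.
Qed.
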